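(* Let $d \ge 1$, let $A \subseteq \mathbb{R}^d$ be a generic thin Delone set, let $k$ be a non-negative integer, and let $a \in A$. Then the $k$-hefty simplices of $A$ having $a$ as a vertex cover every sufficiently small neighborhood of $a$ exactly $\binom{d+k-1}{d-1}$ times; that is, there is $\varepsilon > 0$ such that every point $y$ with $\|y-a\| < \varepsilon$ that is generic with respect to $A$ belongs to exactly $\binom{d+k-1}{d-1}$ $k$-hefty simplices of $A$ having $a$ as a vertex.
   Context: A set $A \subseteq \mathbb{R}^d$ is locally finite if every closed ball contains only finitely many points of $A$, and coarsely dense if every closed half-space contains at least one point of $A$; it is a thin Delone set if it has both properties. $A$ is generic if no $d+1$ of its points lie on a common affine hyperplane and no $d+2$ of its points lie on a common $(d-1)$-sphere. For generic $A$, any $d+1$ of its points span a $d$-simplex with a unique circumscribed $(d-1)$-sphere; a point is inside a sphere if it lies in the interior of the closed ball bounded by it. A $d$-simplex with vertices in $A$ is $k$-hefty if exactly $k$ points of $A$ lie inside its circumscribed sphere. A point $y$ is generic with respect to $A$ if $y \notin A$ and $A \cup \{y\}$ is generic. *)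

(* Defs.v *)
(* Points of R^d are row vectors 'rV[R]_d over an arbitrary realType R.  The
   canonical norm of 'rV[R]_d in MathComp-Analysis is the sup norm, so the
   Euclidean one is defined here. *)
From mathcomp Require Import all_boot all_order all_algebra finmap.
From mathcomp Require Import boolp classical_sets functions cardinality reals.

Set Implicit Arguments.
Unset Strict Implicit.
Unset Printing Implicit Defensive.

Import Order.TTheory GRing.Theory Num.Theory.
Local Open Scope classical_set_scope.
Local Open Scope ring_scope.

Definition edot (R : realType) (d : nat) (u v : 'rV[R]_d) : R :=
  \sum_(i < d) u 0 i * v 0 i.

Definition enorm (R : realType) (d : nat) (u : 'rV[R]_d) : R :=
  Num.sqrt (edot u u).

Definition esphere (R : realType) (d : nat) (c : 'rV[R]_d) (r : R)
  : set 'rV[R]_d := [set x | enorm (x - c) = r].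

Definition eopen_ball (R : realType) (d : nat) (c : 'rV[R]_d) (r : R)
  : set 'rV[R]_d := [set x | enorm (x - c) < r].

Definition eclosed_ball (R : realType) (d : nat) (c : 'rV[R]_d) (r : R)
  : set 'rV[R]_d := [set x | enorm (x - c) <= r].

(* [hyperplane u t] and [closed_halfspace u t] are used only with u != 0. *)
Definition hyperplane (R : realType) (d : nat) (u : 'rV[R]_d) (t : R)
  : set 'rV[R]_d := [set x | edot u x = t].

Definition closed_halfspace (R : realType) (d : nat) (u : 'rV[R]_d) (t : R)
  : set 'rV[R]_d := [set x | edot u x <= t].

Definition locally_finite (R : realType) (d : nat) (A : set 'rV[R]_d) : Prop :=
  forall (c : 'rV[R]_d) (r : R), finite_set (A `&` eclosed_ball c r).

Definition coarsely_dense (R : realType) (d : nat) (A : set 'rV[R]_d) : Prop :=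
  forall (u : 'rV[R]_d) (t : R), u != 0 -> A `&` closed_halfspace u t !=set0.

Definition thin_Delone (R : realType) (d : nat) (A : set 'rV[R]_d) : Prop :=
  locally_finite A /\ coarsely_dense A.

Definition generic (R : realType) (d : nat) (A : set 'rV[R]_d) : Prop :=
  (forall S : {fset 'rV[R]_d}, [set` S] `<=` A -> #|` S| = d.+1 ->
     ~ exists u t, u != 0 /\ [set` S] `<=` hyperplane u t) /\
  (forall S : {fset 'rV[R]_d}, [set` S] `<=` A -> #|` S| = d.+2 ->
     ~ exists c r, 0 < r /\ [set` S] `<=` esphere c r).

Definition generic_wrt (R : realType) (d : nat) (A : set 'rV[R]_d)
    (y : 'rV[R]_d) : Prop :=
  ~ A y /\ generic (A `|` [set y]).

(* A d-simplex is represented by its set of d+1 vertices; affine independence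
   of the vertices is automatic when A is generic. *)
Definition simplex_of (R : realType) (d : nat) (A : set 'rV[R]_d)
    (S : {fset 'rV[R]_d}) : Prop :=
  [set` S] `<=` A /\ #|` S| = d.+1.

(* The geometric simplex spanned by the vertex set S. *)
Definition conv_hull (R : realType) (d : nat) (S : {fset 'rV[R]_d})
  : set 'rV[R]_d :=
  [set y | exists w : 'rV[R]_d -> R,
     [/\ forall x, x \in S -> 0 <= w x,
         \sum_(x <- S) w x = 1
       & y = \sum_(x <- S) w x *: x]].

Definition circumscribed (R : realType) (d : nat) (S : {fset 'rV[R]_d})
    (c : 'rV[R]_d) (r : R) : Prop :=
  0 < r /\ [set` S] `<=` esphere c r.

(* For generic A the circumscribed sphere of S exists and is unique, so the
   existential only names its center and radius. *)
Definition hefty (R : realType) (d : nat) (A : set 'rV[R]_d) (k : nat)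
    (S : {fset 'rV[R]_d}) : Prop :=
  simplex_of A S /\
  exists c r, circumscribed S c r /\ (A `&` eopen_ball c r #= `I_k)%card.

(* Main.v *)
(* The sphere through [a] with center [a + p / 2] has a point [x] inside, on or
   outside according to the sign of [|x - a|^2 - p.(x - a)], which is affine in
   [p].  The spheres through [a] that are empty of points of [A] thus form a
   polytope (the Voronoi cell of [a]), and maximising [p.(y - a)] over it is a
   linear program.  By duality and genericity exactly one empty simplex at [a]
   has [y] in its cone at [a], and this remains true after removing any finite
   set [B] from [A].  A simplex with vertices [a] and [X] whose sphere has inside
   points [I] becomes empty in [A \ B] iff [B] contains [I] and misses [X].
   Counting the pairs (B, X) with [#|B| = m] inside a large finite set of [n]
   points gives [sum_j f_j C(n - d - j, m - j) = C(n, m)], where [f_j] is the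
   number of [j]-hefty simplices with [y] in their cone; this triangular system
   has the solution [f_j = C(d - 1 + j, j)]. *)
Require Import Defs.
From mathcomp Require Import all_boot all_order all_algebra finmap.
From mathcomp Require Import zify ring lra.

Set Implicit Arguments.
Unset Strict Implicit.
Unset Printing Implicit Defensive.

(** * Counting subsets *)

(** Compares coefficients of x^m in the product of (1 - x)^(-r-1) and (1 - x)^(-e-1). The induction
    on [e] and [m] uses Pascal's rule; [e = 0] is the hockey-stick identity. *)
Lemma bin_convolution (r e m : nat) :
  \sum_(i < m.+1) 'C(r + i, i) * 'C(e + (m - i), m - i) = 'C(r + e + m + 1, m).
Proof.
elim: e m => [|e IHe] m.
  elim: m => [|m IHm]; first by rewrite big_ord1 !bin0.
  rewrite big_ord_recr /= subnn bin0 muln1.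
  transitivity ('C(r + 0 + m + 1, m) + 'C(r + m.+1, m.+1)); last first.
    by rewrite addn0 !addn1 addnS binS addnC.
  rewrite -IHm; congr (_ + _); apply: eq_bigr => i _.
  by rewrite /= !add0n !binn.
elim: m => [|m IHm]; first by rewrite big_ord1 !bin0.
transitivity ('C(r + e + m.+1 + 1, m.+1) + 'C(r + e.+1 + m + 1, m)); last first.
  by rewrite !addn1 !addnS !addSn [RHS]binS.
rewrite -IHe -IHm big_ord_recr [in RHS]big_ord_recr /= !subnn !bin0 !muln1
  addnAC; congr (_ + _).
rewrite -big_split /=; apply: eq_bigr => i _.
rewrite -mulnDr; congr (_ * _).
by rewrite subSn ?leq_ord // addSn !addnS binS addnC.
Qed.

(** [B] is determined by [B :\: Y], an arbitrary subset of size [m - #|Y|] of the complement of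
    [X :|: Y]. *)
Lemma card_sets_between (T : finType) (X Y : {set T}) (m : nat) :
  [disjoint X & Y] -> #|Y| <= m ->
  #|[set B : {set T} | [&& #|B| == m, Y \subset B & [disjoint X & B]]]| =
    'C(#|T| - #|X| - #|Y|, m - #|Y|).
Proof.
move=> dXY leYm.
have -> : #|T| - #|X| - #|Y| = #|~: (X :|: Y)|.
  by rewrite [RHS]cardsCs setCK cardsU (disjoint_setI0 dXY) cards0 subn0 subnDA.
rewrite -cards_draws.
set E := [set B | _]; set D := [set B | _].
have inj : {in D &, injective (fun B => B :|: Y)}.
  move=> B B'; rewrite !inE => /andP[sB _] /andP[sB' _] eqBB'.
  have cut (C : {set T}) : C \subset ~: (X :|: Y) -> (C :|: Y) :\: Y = C.
    move=> sC; rewrite setDUl setDv setU0; apply/setDidPl.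
    by rewrite disjoints_subset (subset_trans sC) // setCS subsetUr.
  by rewrite -(cut _ sB) eqBB' cut.
rewrite -(card_in_imset inj); apply: eq_card => B; apply/idP/imsetP.
- rewrite inE => /and3P[/eqP cB sYB dXB]; exists (B :\: Y); last first.
    by rewrite setUC -{1}(setIidPr sYB) setID.
  rewrite inE cardsD (setIidPr sYB) cB eqxx andbT setCU setDE subsetI.
  by rewrite subsetIr andbT (subset_trans (subsetIl _ _)) //
    -disjoints_subset disjoint_sym.
- case=> C; rewrite inE => /andP[sC /eqP cC] ->.
  have : [disjoint C & X] /\ [disjoint C & Y].
    by move: sC; rewrite setCU subsetI !disjoints_subset => /andP[-> ->].
  case=> dCX dCY; rewrite inE subsetUr cardsU (disjoint_setI0 dCY) cards0 subn0 cC.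
  rewrite subnK // eqxx /= disjoints_subset setCU subsetI.
  by rewrite -!disjoints_subset dXY disjoint_sym dCX.
Qed.

(* Double counting of pairs (B, X) with I X inside B and X outside B expresses
   'C(#|T|, m) through the numbers of X with #|I X| = j, for j <= m; the
   system is triangular and is solved by Vandermonde convolution. *)
Lemma card_by_depth (T : finType) (d K : nat) (P : pred {set T})
    (I : {set T} -> {set T}) :
  (forall X, P X -> #|X| = d.+1 /\ [disjoint X & I X]) ->
  (forall B : {set T}, #|B| <= K ->
     #|[set X | [&& P X, I X \subset B & [disjoint X & B]]]| = 1) ->
  forall j, j <= K -> #|[set X | P X && (#|I X| == j)]| = 'C(d + j, j).
Proof.
move=> PX uX.
(* This makes the truncated subtractions below exact. If [T] had fewer than [K] points, [B = T]
   would force [X] to be empty; otherwise a [B] of size [K] leaves room for the [d.+1] points of its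
   [X]. *)
have leTK : K + d.+1 <= #|T|.
  have leKT : K <= #|T|.
    rewrite leqNgt; apply/negP => ltTK.
    have := uX [set: T]; rewrite cardsT (ltnW ltTK) => /(_ isT) /eqP.
    case/cards1P=> X /setP/(_ X); rewrite !inE eqxx => /and3P[/PX[cX _] _].
    by rewrite disjoints_subset setCT subset0 => /eqP X0; rewrite X0 cards0 in cX.
  have : 0 < #|[set B : {set T} | B \subset setT & #|B| == K]|.
    by rewrite cards_draws cardsT bin_gt0.
  case/card_gt0P => B; rewrite inE subsetT => /eqP cB.
  have := uX B; rewrite cB leqnn => /(_ isT) /eqP.
  case/cards1P=> X /setP/(_ X); rewrite !inE eqxx => /and3P[/PX[cX _] _ dXB].
  by rewrite -cX -cB -[X in _ <= X]cardsT addnC -cardsUI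
    (disjoint_setI0 dXB) cards0 addn0 subset_leq_card // subsetT.
pose f j := #|[set X | P X && (#|I X| == j)]|.
have dbl m : m <= K ->
    'C(#|T|, m) = \sum_(j < m.+1) f j * 'C(#|T| - d.+1 - j, m - j).
  move=> lemK; transitivity
      (\sum_(B : {set T} | #|B| == m)
         \sum_(X | [&& P X, I X \subset B & [disjoint X & B]]) 1).
    rewrite -card_draws.
    rewrite -sum1_card; apply: congr_big => // [B|B cB]; first by rewrite inE.
    rewrite sum1_card -[LHS](uX B) ?cardsE ?(eqP cB) //.
    by move: cB; rewrite inE => /eqP ->.
  rewrite (exchange_big_dep (fun X => P X && (#|I X| < m.+1))) /=; last first.
    by move=> B X /eqP cB /and3P[-> sIB _]; rewrite ltnS -cB subset_leq_card.
  rewrite (partition_big (fun X => inord #|I X| : 'I_m.+1) predT) //=.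
  apply: eq_bigr => j _; rewrite /f -sum_nat_const.
  apply: congr_big => // [X|X /andP[/andP[pX ltI] /eqP eqj]].
    rewrite inE -andbA; congr (_ && _); apply/andP/eqP => [[ltI /eqP <-]|->].
      by rewrite inordK.
    by rewrite inord_val eqxx ltn_ord.
  have [cX dXI] := PX _ pX.
  have {eqj ltI} eqj : #|I X| = j by rewrite -eqj inordK.
  rewrite -cX -eqj -card_sets_between //; last by rewrite eqj -ltnS.
  by rewrite sum1_card -[RHS]cardsE; apply: eq_card => B; rewrite !inE pX /=.
elim/ltn_ind=> j IHj lejK; rewrite -/(f j).
have := dbl j lejK; rewrite big_ord_recr /= subnn bin0 muln1.
(* By [bin_convolution] with [e = #|T| - d.+1 - j], the claimed values solve the same equation; the
   induction hypothesis then cancels all terms but the last. *)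
have <- : \sum_(i < j.+1) 'C(d + i, i) * 'C(#|T| - d.+1 - i, j - i) = 'C(#|T|, j).
  have -> : 'C(#|T|, j) = 'C(d + (#|T| - d.+1 - j) + j + 1, j) by congr 'C(_, _); lia.
  rewrite -bin_convolution; apply: eq_bigr => i _; congr (_ * 'C(_, _)).
  by have := leq_ord i; lia.
rewrite big_ord_recr /= subnn bin0 muln1.
under eq_bigr => i _ do rewrite -IHj ?ltn_ord // ?(leq_trans (ltnW (ltn_ord i))) //.
by move/eqP; rewrite eqn_add2l => /eqP.
Qed.

From mathcomp Require Import boolp classical_sets functions cardinality reals.
From mathcomp Require Import topology normedtype derive.

Import Order.TTheory GRing.Theory Num.Theory.
Import numFieldNormedType.Exports.
Local Open Scope classical_set_scope.
Local Open Scope ring_scope.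

(** * Spheres through a point *)

Section Edot.
Variables (R : realType) (d : nat).
Implicit Types (u v w : 'rV[R]_d).

Lemma edotC u v : edot u v = edot v u.
Proof. by apply: eq_bigr => i _; rewrite mulrC. Qed.

Lemma edotDl u v w : edot (u + v) w = edot u w + edot v w.
Proof. by rewrite -big_split; apply: eq_bigr => i _; rewrite mxE mulrDl. Qed.

Lemma edotZl (t : R) u v : edot (t *: u) v = t * edot u v.
Proof. by rewrite [RHS]mulr_sumr; apply: eq_bigr => i _; rewrite mxE mulrA. Qed.

Lemma edotNl u v : edot (- u) v = - edot u v.
Proof. by rewrite -scaleN1r edotZl mulN1r. Qed.

Lemma edotBl u v w : edot (u - v) w = edot u w - edot v w.
Proof. by rewrite edotDl edotNl. Qed.

Lemma edotDr u v w : edot u (v + w) = edot u v + edot u w.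
Proof. by rewrite edotC edotDl !(edotC u). Qed.

Lemma edotZr (t : R) u v : edot u (t *: v) = t * edot u v.
Proof. by rewrite edotC edotZl edotC. Qed.

Lemma edotNr u v : edot u (- v) = - edot u v.
Proof. by rewrite edotC edotNl edotC. Qed.

Lemma edotBr u v w : edot u (v - w) = edot u v - edot u w.
Proof. by rewrite edotDr edotNr. Qed.

Lemma edot0r u : edot u 0 = 0.
Proof. by rewrite -(scale0r 0) edotZr mul0r. Qed.

Lemma edot0l u : edot 0 u = 0.
Proof. by rewrite edotC edot0r. Qed.

Lemma edot_sumr (I : Type) (s : seq I) u (F : I -> 'rV[R]_d) :
  edot u (\sum_(i <- s) F i) = \sum_(i <- s) edot u (F i).
Proof.
by apply: (big_morph (edot u)) => [v w|]; rewrite ?edotDr ?edot0r.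
Qed.

Lemma edot_ge0 u : 0 <= edot u u.
Proof. by apply: sumr_ge0 => i _; rewrite -expr2 sqr_ge0. Qed.

Lemma edot_eq0 u : (edot u u == 0) = (u == 0).
Proof.
apply/eqP/eqP => [|->]; last exact: edot0r.
move/psumr_eq0P => h; apply/rowP => i; rewrite mxE; apply/eqP.
have /eqP : u 0 i * u 0 i = 0 by apply: h => // j _; rewrite -expr2 sqr_ge0.
by rewrite mulf_eq0 orbb.
Qed.

Lemma edot_gt0 u : (0 < edot u u) = (u != 0).
Proof. by rewrite lt_def edot_ge0 andbT edot_eq0. Qed.

Lemma edot_AGM u v : edot u v *+ 2 <= edot u u + edot v v.
Proof.
have := edot_ge0 (u - v); rewrite edotBl !edotBr (edotC v u); lra.
Qed.

End Edot.

Lemma fset_subcard (T : choiceType) (X : {fset T}) (n : nat) :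
  (n <= #|` X|)%N -> exists2 Y : {fset T}, (Y `<=` X)%fset & #|` Y| = n.
Proof.
elim: n => [|n IHn] ltnX; first by exists fset0; rewrite ?fsub0set ?cardfs0.
have [Y sYX cY] := IHn (ltnW ltnX).
have : (0 < #|` (X `\` Y)%fset|)%N.
  by rewrite cardfsD (fsetIidPr sYX) cY subn_gt0.
rewrite cardfs_gt0 => /fset0Pn[x]; rewrite inE => /andP[xY xX].
by exists (x |` Y)%fset; rewrite ?fsubUset ?fsub1set ?xX // cardfsU1 xY cY.
Qed.

(* The power of [x] with respect to the sphere through [a] with center
   [a + p / 2]. *)
Definition power (R : realType) (d : nat) (a p x : 'rV[R]_d) : R :=
  edot (x - a) (x - a) - edot p (x - a).

Section Power.
Variables (R : realType) (d : nat) (a : 'rV[R]_d).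
Implicit Types (c p x : 'rV[R]_d) (r : R).

(** For center [c] this is the classical power: squared distance to the center minus squared
    radius. *)
Lemma powerE c x :
  power a (2 *: (c - a)) x = edot (x - c) (x - c) - edot (a - c) (a - c).
Proof.
rewrite /power edotZl !(edotBl, edotBr) (edotC a x) (edotC c x) (edotC a c).
by ring.
Qed.

Lemma power_self p : power a p a = 0.
Proof. by rewrite /power subrr !edot0r subrr. Qed.

Lemma esphere_power c r x : esphere c r a ->
  esphere c r x <-> power a (2 *: (c - a)) x = 0.
Proof.
rewrite /esphere /= /enorm powerE => <-; split => [/eqP|/eqP].
  by rewrite eqr_sqrt ?edot_ge0 // => /eqP ->; rewrite subrr.
by rewrite subr_eq0 => /eqP ->.
Qed.

Lemma eopen_ball_power c r x : 0 < r -> esphere c r a ->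
  eopen_ball c r x <-> power a (2 *: (c - a)) x < 0.
Proof.
rewrite /esphere /eopen_ball /= /enorm powerE subr_lt0 => + rE.
by rewrite -rE sqrtr_gt0 => r0; rewrite ltr_sqrt.
Qed.

Lemma power_center p : exists c : 'rV[R]_d, p = 2 *: (c - a).
Proof.
exists (a + 2^-1 *: p); rewrite addrAC subrr add0r scalerA divff ?scale1r //.
by rewrite pnatr_eq0.
Qed.

(** The length of [p] is the diameter of the sphere, so all points on or inside it are within that
    distance of [a]. *)
Lemma power_le0_bound p x : power a p x <= 0 ->
  edot (x - a) (x - a) <= edot p p.
Proof. by have := edot_AGM p (x - a); rewrite /power; lra. Qed.

Lemma power_le0_neq0 p x : x != a -> power a p x <= 0 -> p != 0.
Proof.
move=> xa; apply: contraTneq => ->.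
by rewrite /power edot0l subr0 -ltNge edot_gt0 subr_eq0.
Qed.

End Power.

(** * Consequences of genericity at [a] *)

Section Generic.
Variables (R : realType) (d : nat) (A : set 'rV[R]_d) (a : 'rV[R]_d).
Hypotheses (genA : generic A) (Aa : A a).
Implicit Types (p x y z : 'rV[R]_d) (X Z : {fset 'rV[R]_d}).

(** Any [d.+1] such points and [a] would be [d.+2] cospherical points; the radius is positive
    because the sphere has a point other than [a]. *)
Lemma generic_cosphere p X : [set` X] `<=` A -> a \notin X ->
  (forall x, x \in X -> power a p x = 0) -> (#|` X| <= d)%N.
Proof.
move=> XA aX pX; rewrite leqNgt; apply/negP => /fset_subcard[Y sYX cY].
have aY : a \notin Y by apply: contra aX; exact: (fsubsetP sYX).
have sub : [set` (a |` Y)%fset] `<=` A.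
  by move=> x /=; rewrite !inE => /orP[/eqP ->//|/(fsubsetP sYX)/XA].
apply: (genA.2 _ sub); first by rewrite cardfsU1 aY cY.
have [c pE] := power_center a p.
have [x xY] : exists x, x \in Y.
  by apply/fset0Pn; rewrite -cardfs_gt0 cY.
exists c, (enorm (a - c)); split.
  have xa : x != a by apply: contraNneq aY => <-.
  have := power_le0_neq0 (p := p) xa; rewrite pX ?(fsubsetP sYX) // lexx => /(_ isT).
  rewrite sqrtr_gt0 edot_gt0; apply: contraNneq => /subr0_eq acE.
  by rewrite pE acE subrr scaler0.
move=> z /=; rewrite !inE => /orP[/eqP ->//|/(fsubsetP sYX) zX].
by apply/(esphere_power (a := a)) => //; rewrite -pE pX.
Qed.

(** A nonzero vector orthogonal to all [z - a] would put the [d.+1] points [a] and [Z] on a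
    hyperplane. So these vectors form a basis, and [q] is its dual basis. *)
Lemma generic_dual_basis Z : [set` Z] `<=` A -> a \notin Z -> #|` Z| = d ->
  exists q : 'rV[R]_d -> 'rV[R]_d,
    (forall z z', z \in Z -> z' \in Z -> edot (q z) (z' - a) = (z == z')%:R) /\
    (forall u, u = \sum_(z <- Z) edot (q z) u *: (z - a)).
Proof.
move=> ZA aZ cZ.
pose M : 'M[R]_d := \matrix_(i < d) (nth 0 Z i - a).
have uM : M \in unitmx.
  rewrite unitmxE unitfE -det_tr; apply/det0P => -[v v0 vM].
  have sub : [set` (a |` Z)%fset] `<=` A.
    by move=> x /=; rewrite !inE => /orP[/eqP ->//|/ZA].
  apply: (genA.1 _ sub); first by rewrite cardfsU1 aZ cZ.
  exists v, (edot v a); split => // x /=; rewrite !inE => /orP[/eqP ->//|xZ].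
  have ix : (index x Z < d)%N by rewrite -[ltnRHS]cZ index_mem.
  apply/eqP; rewrite -subr_eq0 -edotBr; apply/eqP.
  move/rowP: vM => /(_ (Ordinal ix)); rewrite !mxE => <-.
  by apply: eq_bigr => i _; rewrite !mxE nth_index.
pose N := invmx M.
(* Column [index z Z] of [N], written as a sum with at most one term so that the index need not be
   an ordinal. *)
pose q z : 'rV[R]_d := \row_k \sum_(i < d | i == index z Z :> nat) N k i.
have qE (i : 'I_d) : q (nth 0 Z i) = \row_k N k i.
  apply/rowP => k; rewrite !mxE index_uniq ?fset_uniq ?cZ //.
  by rewrite (big_pred1 i).
have qM (i : 'I_d) u : edot (q (nth 0 Z i)) u = (u *m N) 0 i.
  by rewrite qE edotC mxE; apply: eq_bigr => k _; rewrite !mxE.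
exists q; split => [z z' zZ z'Z|u].
  have iz : (index z Z < d)%N by rewrite -[ltnRHS]cZ index_mem.
  have iz' : (index z' Z < d)%N by rewrite -[ltnRHS]cZ index_mem.
  rewrite -[in LHS](nth_index 0 zZ) -[in LHS](nth_index 0 z'Z).
  rewrite (qM (Ordinal iz)).
  have -> : nth 0 Z (index z' Z) - a = row (Ordinal iz') M.
    by apply/rowP => k; rewrite !mxE.
  rewrite -row_mul mulmxV // row1 mxE eqxx -val_eqE /= eq_sym.
  have [->|nzz'] := eqVneq z z'; first by rewrite eqxx.
  case: eqP => // /(congr1 (nth 0 Z)); rewrite !nth_index // => eqz.
  by rewrite eqz eqxx in nzz'.
rewrite {1}(_ : u = u *m N *m M); last by rewrite -mulmxA mulVmx ?mulmx1.
rewrite mulmx_sum_row (big_nth 0) big_mkord cZ.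
by apply: eq_bigr => i _; rewrite qM rowK.
Qed.

(** Otherwise [y], [a] and the points of [Z] other than [z] are [d.+1] points on a hyperplane. Hence
    [y - a] has no zero coordinate in the basis given by [Z]. *)
Lemma generic_wrt_dual_neq0 y Z z (u : 'rV[R]_d) : generic_wrt A y ->
  [set` Z] `<=` A -> a \notin Z -> #|` Z| = d -> z \in Z -> u != 0 ->
  (forall z', z' \in Z -> z' != z -> edot u (z' - a) = 0) ->
  edot u (y - a) != 0.
Proof.
move=> [nAy [genAy _]] ZA aZ cZ zZ u0 uZ; apply/eqP => uy.
have sub : [set` (y |` (a |` (Z `\ z)))%fset] `<=` A `|` [set y].
  move=> x /=; rewrite !inE => /or3P[/eqP ->|/eqP ->|/andP[_ /ZA]];
  by [right|left|left].
apply: (genAy _ sub).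
  have ya : y != a by apply: contra_notN nAy => /eqP ->.
  have yZ : y \notin Z by apply: contra_notN nAy => /ZA.
  rewrite !cardfsU1 !inE (negbTE ya) (negbTE aZ) (negbTE yZ) !andbF /=.
  by have := cardfsD1 z Z; rewrite zZ cZ !add1n => <-.
exists u, (edot u a); split => // x /=.
rewrite !inE /hyperplane /= => xE; apply/eqP; rewrite -subr_eq0 -edotBr.
case/or3P: xE => [/eqP ->|/eqP ->|/andP[xz xZ]]; first exact/eqP.
  by rewrite subrr edot0r.
by apply/eqP/uZ.
Qed.

End Generic.

(** * Spheres with few inside points are bounded *)

Lemma near_fset (T : Type) (K : choiceType) (F : set_system T)
    {FF : Filter F} (G : {fset K}) (P : K -> T -> Prop) :
  (forall x, x \in G -> \forall t \near F, P x t) ->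
  \forall t \near F, forall x, x \in G -> P x t.
Proof.
move=> PG; have := filter_bigI (f := fun x => [set t | P x t]) FF PG.
by apply: filterS => t /= Pt x xG; exact: Pt.
Qed.


Section Topology.
Variables (R : realType) (d : nat).
Implicit Types (p u v x : 'rV[R]_d).

Lemma edot_continuous x : continuous (fun p => edot p x).
Proof.
rewrite /edot; elim: (index_enum _) => [|i s IHs] p.
  rewrite (_ : (fun _ => _) = cst 0); first exact: cst_continuous.
  by apply/funext => q; rewrite big_nil.
rewrite (_ : (fun _ => _) =
    (fun q : 'rV[R]_d => q 0 i * x 0 i + \sum_(j <- s) q 0 j * x 0 j)); last first.
  by apply/funext => q; rewrite big_cons.
apply: (@continuousD _ _ _ (fun q : 'rV[R]_d => q 0 i * x 0 i)); last exact: IHs.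
by apply: continuousM; [exact: coord_continuous | exact: cst_continuous].
Qed.

Lemma coord_le_norm p i : `|p 0 i| <= `|p|.
Proof.
rewrite [leRHS]/Num.norm /= mx_normrE.
exact: (le_bigmax _ (fun ij : 'I_1 * 'I_d => `|p ij.1 ij.2|) (0, i)).
Qed.

Lemma edot_le_norm p : edot p p <= `|p| ^+ 2 *+ d.
Proof.
have <- : \sum_(i < d) `|p| ^+ 2 = `|p| ^+ 2 *+ d by rewrite sumr_const card_ord.
apply: ler_sum => i _.
by rewrite -expr2 -real_normK ?num_real // lerXn2r ?nnegrE ?coord_le_norm.
Qed.

Lemma coarsely_dense_draw (A : set 'rV[R]_d) (a v : 'rV[R]_d) (k : nat) :
  coarsely_dense A -> v != 0 ->
  exists G : {fset 'rV[R]_d}, [/\ [set` G] `<=` A, #|` G| = k &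
    forall x, x \in G -> 1 <= edot v (x - a)].
Proof.
move=> dnA v0; elim: k => [|k [G [GA cG G1]]].
  by exists fset0; split => //; rewrite cardfs0.
have Nv0 : - v != 0 by rewrite oppr_eq0.
(* Beyond this threshold [edot v (x - a)] exceeds all its values on [G], so the new point is
   distinct from the old ones. *)
have [x [Ax]] := dnA (- v) (- edot v a - 1 - \sum_(x <- G) `|edot v (x - a)|) Nv0.
rewrite /closed_halfspace /= edotNl => xle.
have {}xle : 1 + \sum_(x <- G) `|edot v (x - a)| <= edot v (x - a).
  by rewrite edotBr; lra.
have xG : x \notin G.
  apply/negP => xG; have : `|edot v (x - a)| <= \sum_(x <- G) `|edot v (x - a)|.
    by rewrite (big_fsetD1 x) //= lerDl sumr_ge0.
  have := ler_norm (edot v (x - a)); lra.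
exists (x |` G)%fset; split => [z /=|| z]; rewrite ?cardfsU1 ?xG ?cG //.
  by rewrite !inE => /orP[/eqP ->//|/GA].
rewrite !inE => /orP[/eqP ->|/G1//]; apply: le_trans xle.
by rewrite lerDl sumr_ge0.
Qed.

(* Any sphere through [a] of large radius almost contains a half-space, so it
   has more than [k] points inside; compactness of the set of directions makes
   the radius bound uniform. *)
Lemma few_inside_bounded (A : set 'rV[R]_d) (a : 'rV[R]_d) (k : nat) :
  coarsely_dense A -> exists C : R, forall p,
    (forall G : {fset 'rV[R]_d}, [set` G] `<=` A ->
      (forall x, x \in G -> power a p x < 0) -> (#|` G| <= k)%N) ->
    `|p| <= C.
Proof.
move=> dnA.
pose P (t : R) v := exists G : {fset 'rV[R]_d},
  [/\ [set` G] `<=` A, #|` G| = k.+1 &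
    forall x, x \in G -> power a (t *: v) x < 0].
have cS : compact [set v : 'rV[R]_d | `|v| = 1].
  apply: bounded_closed_compact.
    by exists 1; split => // r r1 v /= ->; exact: ltW.
  rewrite (_ : mkset _ = Num.norm @^-1` [set 1]) //.
  apply: closed_comp; last exact: closed_eq.
  by move=> v _; exact: norm_continuous.
have /(_ _ (pinfty_nbhs R) P _) := (compact_near_coveringP _).1 cS.
case.
- move=> v /= v1.
  have v0 : v != 0 by rewrite -normr_gt0 v1.
  have [G [GA cG G1]] := coarsely_dense_draw a k.+1 dnA v0.
  (* For [v'] and [t] in these sets every [x] in [G] is inside the sphere of [t *: v'], so one [G]
     serves a whole neighborhood of [v]. *)
  exists ([set v' | forall x, x \in G -> 2^-1 < edot v' (x - a)],
          [set t | forall x, x \in G -> 2 * edot (x - a) (x - a) < t]) => /=.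
    split.
      apply: (@near_fset _ _ (nbhs v)) => x xG.
      apply: (@cvgr_gt _ _ _ _ (fun v' => edot v' (x - a)) (edot v (x - a))).
        exact: edot_continuous.
      by have := G1 x xG; lra.
    apply: (@near_fset _ _ (pinfty_nbhs R)) => x xG.
    exact: nbhs_pinfty_gt (num_real _).
  move=> [v' t] /= [Gv' Gt]; exists G; split => // x xG.
  have := Gv' x xG; have := Gt x xG; have := edot_ge0 (x - a).
  rewrite /power edotZl; nra.
- move=> C [_ CP]; exists (`|C| + 1) => p few; rewrite leNgt; apply/negP => ltCp.
  have p0 : 0 < `|p| by apply: le_lt_trans ltCp; rewrite addr_ge0.
  have ltCp' : C < `|p|.
    apply: le_lt_trans ltCp; apply: (le_trans (ler_norm C)); rewrite lerDl //.
  have [] := CP _ ltCp' (`|p|^-1 *: p).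
    by rewrite /= normrZ normfV normr_id mulVf ?gt_eqF.
  move=> G [GA cG]; rewrite scalerA divff ?gt_eqF // scale1r => Gp.
  by have := few G GA Gp; rewrite cG ltnn.
Qed.
End Topology.

(** * The unique empty simplex in a given direction *)

(* [p] encodes the point [a + p / 2] of the Voronoi cell of [a]. *)
Definition voronoi (R : realType) (d : nat) (A : set 'rV[R]_d) (a p : 'rV[R]_d)
  : Prop := forall x, A x -> 0 <= power a p x.

(* [a] together with [X] is a simplex of [A], its circumscribed sphere is
   encoded by [p], and its cone at [a] contains [y]. *)
Definition star_cell (R : realType) (d : nat) (A : set 'rV[R]_d)
    (a y : 'rV[R]_d) (X : {fset 'rV[R]_d}) (p : 'rV[R]_d) : Prop :=
  [/\ [set` X] `<=` A, a \notin X, #|` X| = d,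
      forall x, x \in X -> power a p x = 0 &
      exists w : 'rV[R]_d -> R, (forall x, x \in X -> 0 <= w x) /\
        y - a = \sum_(x <- X) w x *: (x - a)].

Section Star.
Variables (R : realType) (d : nat) (A : set 'rV[R]_d) (a : 'rV[R]_d).
Hypothesis Aa : A a.
Implicit Types (p q x y z : 'rV[R]_d) (X Z : {fset 'rV[R]_d}).

Lemma locally_finite_edot (t : R) : locally_finite A ->
  exists F : {fset 'rV[R]_d},
    forall x, x \in F <-> A x /\ edot (x - a) (x - a) <= t.
Proof.
move=> lfA; have [t0|t0] := leP 0 t; last first.
  exists fset0 => x; rewrite inE; split => // -[_].
  by move/le_lt_trans/(_ t0); rewrite ltNge edot_ge0.
have /finite_fsetP[F AF] := lfA a (Num.sqrt t).
exists F => x.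
have : [set` F] x <-> (A `&` eclosed_ball a (Num.sqrt t)) x by rewrite AF.
by rewrite /eclosed_ball /setI /= /enorm ler_sqrt.
Qed.

(** For small [e] active constraints are not worsened and inactive ones keep their slack. Only
    finitely many points matter: for [e < 1], [p + e *: q] has squared length at most the bound
    defining [F]. *)
Lemma voronoi_improve p q : locally_finite A -> voronoi A a p ->
  (forall x, A x -> power a p x = 0 -> edot q (x - a) <= 0) ->
  exists2 e : R, 0 < e & voronoi A a (p + e *: q).
Proof.
move=> lfA Vp qle.
have [F FE] := locally_finite_edot ((edot p p + edot q q) *+ 2) lfA.
have : \forall e \near 0^'+, [/\ 0 < e, e < 1 &
    forall x, x \in F -> 0 <= power a (p + e *: q) x].
  have nF : \forall e \near 0^'+, forall x, x \in F -> 0 <= power a (p + e *: q) x.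
    apply: (@near_fset R _ 0^'+) => x /FE[Ax _].
    have pE e : power a (p + e *: q) x = power a p x - e * edot q (x - a).
      by rewrite /power (edotDl p) edotZl; ring.
    have [qx|qx] := leP (edot q (x - a)) 0.
      near=> e; rewrite pE.
      have e0 : 0 < e by near: e; exact: nbhs_right_gt.
      by have := Vp x Ax; nra.
    have px : 0 < power a p x.
      rewrite lt_def Vp // andbT; apply/eqP => px.
      by have := qle x Ax px; lra.
    near=> e; rewrite pE subr_ge0 -ler_pdivlMr // ltW //.
    by near: e; apply: nbhs_right_lt; rewrite divr_gt0.
  near=> e; split.
  - by near: e; exact: nbhs_right_gt.
  - by near: e; exact: nbhs_right_lt.
  - by near: e; exact: nF.
case/filter_ex => e [e0 e1 Fe]; exists e => // x Ax.
rewrite leNgt; apply/negP => px; move: (px); apply/negP; rewrite -leNgt.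
apply/Fe/FE; split => //; apply: (le_trans (power_le0_bound (ltW px))).
rewrite edotDl !edotDr !edotZl !edotZr (edotC q p).
have := edot_AGM p (e *: q); rewrite edotZr edotZl edotZr.
have := edot_ge0 q; have := edot_ge0 p.
have : e * e <= 1 by nra.
have := edot_ge0 (p - q); rewrite edotBl !edotBr (edotC q p).
nra.
Unshelve. all: by end_near. Qed.

(** The cell contains 0, is closed as an intersection of half-spaces, and is bounded by
    [few_inside_bounded] for spheres without inside points. *)
Lemma voronoi_max y : coarsely_dense A ->
  exists2 p, voronoi A a p &
    forall q, voronoi A a q -> edot q (y - a) <= edot p (y - a).
Proof.
move=> dnA.
have cV : compact [set p | voronoi A a p].
  apply: bounded_closed_compact.
    have [C HC] := few_inside_bounded a 0 dnA.
    exists C; split; first exact: num_real.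
    move=> r ltCr p /= Vp; apply: le_trans (ltW ltCr); apply: HC => G GA Gp.
    rewrite leqn0 cardfs_eq0; apply/eqP/fsetP => x; rewrite inE.
    by apply/negP => xG; have := Gp x xG; rewrite ltNge Vp //; exact: GA.
  rewrite (_ : mkset _ = \bigcap_(x in A)
      ((fun p => edot p (x - a)) @^-1` [set t | t <= edot (x - a) (x - a)])).
    apply: closed_bigI => x _; apply: closed_comp; last exact: closed_le.
    by move=> p _; exact: edot_continuous.
  by apply/seteqP; split => p Vp x Ax; have := Vp x Ax; rewrite /power /= subr_ge0.
have V0 : [set p | voronoi A a p] !=set0.
  by exists 0 => x _; rewrite /power edot0l subr0 edot_ge0.
have [|p pV pmax] := @EVT_max_rV R d (fun p => edot p (y - a)) _ V0 cV.
  apply: continuous_subspaceT; exact: edot_continuous.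
exists p; first by move: pV; rewrite inE.
by move=> q Vq; apply: pmax; rewrite inE.
Qed.

(** Completes the active points to a basis at [a] before it is known that there are [d] of them. *)
Lemma extend_to_card X : (0 < d)%N -> coarsely_dense A -> [set` X] `<=` A ->
  a \notin X -> (#|` X| <= d)%N ->
  exists Z, [/\ [set` Z] `<=` A, a \notin Z, #|` Z| = d & (X `<=` Z)%fset].
Proof.
move=> d0 dnA XA aX cX.
have v0 : const_mx 1 != 0 :> 'rV[R]_d.
  by apply/eqP => /rowP/(_ (Ordinal d0)); rewrite !mxE => /eqP; rewrite oner_eq0.
have [G [GA cG _]] := coarsely_dense_draw a (d + #|` X|.+1) dnA v0.
have : (d - #|` X| <= #|` (G `\` (a |` X))%fset|)%N.
  have := fsubset_leq_card (fsubsetIr G (a |` X)%fset).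
  by rewrite cardfsD cG cardfsU1 aX; lia.
case/fset_subcard => Y sY cY; exists (X `|` Y)%fset.
have YG x : x \in Y -> [/\ x \in G, x != a & x \notin X].
  by move/(fsubsetP sY); rewrite !inE negb_or -andbA => /and3P[].
have XY0 : (X `&` Y = fset0)%fset.
  by apply/fsetP => x; rewrite !inE; apply/negP => /andP[xX /YG[_ _]]; rewrite xX.
split; last exact: fsubsetUl.
- by move=> x /=; rewrite inE => /orP[/XA//|/YG[/GA]].
- by rewrite inE (negbTE aX) /=; apply/negP => /YG[_ /eqP].
- by rewrite cardfsU XY0 cardfs0 subn0 cY subnKC.
Qed.

Hypothesis genA : generic A.

Lemma star_weight y Z q (w : 'rV[R]_d -> R) z : z \in Z ->
  (forall z', z' \in Z -> edot q (z' - a) = (z == z')%:R) ->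
  y - a = \sum_(x <- Z) w x *: (x - a) -> w z = edot q (y - a).
Proof.
move=> zZ qZ ->; rewrite edot_sumr (big_fsetD1 z) //= edotZr qZ // eqxx mulr1.
rewrite big_seq big1 ?addr0 // => x; rewrite !inE => /andP[xz xZ].
by rewrite edotZr qZ // eq_sym (negbTE xz) mulr0.
Qed.

Lemma dual_edot_neq0 y Z (q : 'rV[R]_d -> 'rV[R]_d) z : generic_wrt A y ->
  [set` Z] `<=` A -> a \notin Z -> #|` Z| = d ->
  (forall z z', z \in Z -> z' \in Z -> edot (q z) (z' - a) = (z == z')%:R) ->
  z \in Z -> edot (q z) (y - a) != 0.
Proof.
move=> gy ZA aZ cZ qZ zZ; apply: (generic_wrt_dual_neq0 _ gy ZA aZ cZ zZ) => //.
  apply/eqP => q0; have := qZ z z zZ zZ; rewrite q0 edot0l eqxx => /esym/eqP.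
  by rewrite oner_eq0.
by move=> z' z'Z z'z; rewrite qZ // eq_sym (negbTE z'z).
Qed.

(* Linear programming: at the vertex of the Voronoi cell farthest in direction
   [y - a], genericity leaves exactly [d] active constraints, and their normals
   generate a cone containing that direction. *)
Lemma empty_star_exists y : (0 < d)%N -> thin_Delone A -> generic_wrt A y ->
  exists X p, star_cell A a y X p /\ voronoi A a p.
Proof.
move=> d0 [lfA dnA] gy; have [p Vp pmax] := voronoi_max y dnA.
have opt q : (forall x, A x -> power a p x = 0 -> edot q (x - a) <= 0) ->
    edot q (y - a) <= 0.
  case/(voronoi_improve lfA Vp) => e e0 /pmax.
  by rewrite edotDl edotZl gerDl pmulr_rle0.
have [F FE] := locally_finite_edot (edot p p) lfA.
pose X := [fset x in F | (x != a) && (power a p x == 0)]%fset.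
have XE x : x \in X <-> [/\ A x, x != a & power a p x = 0].
  rewrite !inE /=; split=> [/and3P[/FE[Ax _] xa /eqP px]//|[Ax xa px]].
  rewrite xa px eqxx !andbT; apply/FE; split => //.
  by apply: power_le0_bound; rewrite px.
have XA : [set` X] `<=` A by move=> x /XE[].
have aX : a \notin X by apply/negP => /XE[_ /eqP].
have cX : (#|` X| <= d)%N.
  by apply: (generic_cosphere genA Aa XA aX (p := p)) => x /XE[].
have [Z [ZA aZ cZ sXZ]] := extend_to_card d0 dnA XA aX cX.
have [q [qZ qy]] := generic_dual_basis genA Aa ZA aZ cZ.
have active x : A x -> power a p x = 0 -> x = a \/ x \in X.
  by move=> Ax px; have [->|xa] := eqVneq x a; [left | right; apply/XE].
(* The direction [- q z] respects the active constraints, so by optimality the weight is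
   nonnegative; genericity of [y] excludes 0. *)
have lam_gt0 z : z \in Z -> 0 < edot (q z) (y - a).
  move=> zZ; rewrite lt_def (dual_edot_neq0 gy ZA aZ cZ qZ zZ) /=.
  rewrite -oppr_le0 -edotNl; apply: opt => x Ax /(active _ Ax)[->|xX].
    by rewrite subrr edot0r.
  have xZ := fsubsetP sXZ _ xX.
  by rewrite edotNl qZ // oppr_le0 ler0n.
(* If [z] were inactive, [q z] would also respect the active constraints, making the weight
   nonpositive. *)
have ZX z : z \in Z -> z \in X.
  move=> zZ; apply: contraT => zX.
  have : edot (q z) (y - a) <= 0.
    apply: opt => x Ax /(active _ Ax)[->|xX]; first by rewrite subrr edot0r.
    have xZ := fsubsetP sXZ _ xX.
    rewrite qZ //; case: eqVneq => // zx.
    by rewrite zx xX in zX.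
  by rewrite leNgt lam_gt0.
exists Z, p; split => //; split => //; first by move=> x /ZX/XE[].
exists (fun z => edot (q z) (y - a)); split=> [x xZ|]; last exact: qy.
exact: ltW (lam_gt0 _ xZ).
Qed.

(** Complementary slackness: by [key], the two objective differences are nonnegative weighted sums
    of powers and add up to 0, so both vanish. The weights on [X] are nonzero by genericity, so [X]
    and [X'] lie on the sphere of [p'], which has room for only [d] points besides [a]. *)
Lemma empty_star_unique y X p X' p' : generic_wrt A y ->
  star_cell A a y X p -> voronoi A a p ->
  star_cell A a y X' p' -> voronoi A a p' -> X = X'.
Proof.
move=> gy [XA aX cX Xp [w [w0 yw]]] Vp [XA' aX' cX' Xp' [w' [w0' yw']]] Vp'.
have key (Y : {fset 'rV[R]_d}) s t (v : 'rV[R]_d -> R) :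
    (forall x, x \in Y -> power a s x = 0) ->
    y - a = \sum_(x <- Y) v x *: (x - a) ->
    edot s (y - a) - edot t (y - a) = \sum_(x <- Y) v x * power a t x.
  move=> Ys ->; rewrite !edot_sumr -sumrB; apply: eq_big_seq => x xY.
  by rewrite !edotZr -mulrBr /power; have := Ys x xY; rewrite /power => /subr0_eq <-.
have ge0 (Y : {fset 'rV[R]_d}) t (v : 'rV[R]_d -> R) : [set` Y] `<=` A ->
    (forall x, x \in Y -> 0 <= v x) -> voronoi A a t ->
    forall x, x \in Y -> 0 <= v x * power a t x.
  by move=> YA v0 Vt x xY; rewrite mulr_ge0 ?v0 ?Vt //; exact: YA.
have sum0 : \sum_(x <- X) w x * power a p' x = 0.
  have le1 : 0 <= \sum_(x <- X) w x * power a p' x.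
    by rewrite big_seq sumr_ge0 //; exact: ge0.
  have le2 : 0 <= \sum_(x <- X') w' x * power a p x.
    by rewrite big_seq sumr_ge0 //; exact: ge0.
  have e1 := key X p p' w Xp yw.
  have e2 := key X' p' p w' Xp' yw'.
  by lra.
have [q [qX _]] := generic_dual_basis genA Aa XA aX cX.
have p'X x : x \in X -> power a p' x = 0.
  move=> xX; have : w x * power a p' x = 0.
    move: sum0; rewrite (big_fsetD1 x) //= => /eqP; rewrite paddr_eq0.
    - by case/andP => /eqP.
    - exact: ge0 xX.
    - rewrite big_seq sumr_ge0 // => z; rewrite !inE => /andP[_ zX].
      exact: ge0 zX.
  move/eqP; rewrite mulf_eq0 => /orP[|/eqP//].
  rewrite (star_weight xX _ yw (q := q x)) => [|z zX]; last exact: qX.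
  by rewrite (negbTE (dual_edot_neq0 gy XA aX cX qX xX)).
have : (#|` (X `|` X')%fset| <= d)%N.
  apply: (generic_cosphere genA Aa (p := p')).
  - by move=> x /=; rewrite inE => /orP[/XA|/XA'].
  - by rewrite inE negb_or aX.
  - by move=> x; rewrite inE => /orP[/p'X|/Xp'].
move=> cU; have eX : X = (X `|` X')%fset.
  by apply/eqP; rewrite eqEfcard fsubsetUl cX.
have eX' : X' = (X `|` X')%fset.
  by apply/eqP; rewrite eqEfcard fsubsetUr cX'.
exact: etrans eX (esym eX').
Qed.

End Star.

(** * Stability under removal of finitely many points *)

Section RemovePoints.
Variables (R : realType) (d : nat).

Lemma generic_sub (A A' : set 'rV[R]_d) : A' `<=` A -> generic A -> generic A'.
Proof.
by move=> sA [g1 g2]; split => S /subset_trans/(_ sA); [exact: g1 | exact: g2].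
Qed.

Lemma generic_wrt_sub (A A' : set 'rV[R]_d) y : A' `<=` A -> generic_wrt A y ->
  generic_wrt A' y.
Proof.
move=> sA [nAy gAy]; split; first by move/sA.
by apply: generic_sub gAy; exact: setSU.
Qed.

Lemma thin_DeloneD (A : set 'rV[R]_d) (B : {fset 'rV[R]_d}) : thin_Delone A ->
  thin_Delone (A `\` [set` B]).
Proof.
move=> [lfA dnA]; split => [c r|u t u0].
  by apply: sub_finite_set (lfA c r) => x [[]].
(* A half-space beyond all points of [B] yields a point that survives the removal. *)
have [x [Ax]] := dnA u (- `|t| - 1 - \sum_(b <- B) `|edot u b|) u0.
rewrite /closed_halfspace /= => xle.
have s0 : 0 <= \sum_(b <- B) `|edot u b| by rewrite sumr_ge0.
have tle : - `|t| <= t by rewrite lerNl -normrN ler_norm.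
exists x; split; last by rewrite /closed_halfspace /=; lra.
split => //= xB; have : `|edot u x| <= \sum_(b <- B) `|edot u b|.
  by rewrite (big_fsetD1 x) //= lerDl sumr_ge0.
have := ler_norm (- edot u x); rewrite normrN.
have := normr_ge0 t; lra.
Qed.

End RemovePoints.

(** * Simplices and cones near [a] *)

Section Hull.
Variables (R : realType) (d : nat) (A : set 'rV[R]_d) (a : 'rV[R]_d).
Implicit Types (p u x y : 'rV[R]_d) (X : {fset 'rV[R]_d}).

Lemma separated_point : locally_finite A ->
  exists2 m : R, 0 < m & forall x, A x -> x != a -> m <= edot (x - a) (x - a).
Proof.
move=> lfA; have [F FE] := locally_finite_edot a 1 lfA.
have : \forall m \near 0^'+, [/\ 0 < m, m < 1 &
    forall x, x \in F -> x != a -> m <= edot (x - a) (x - a)].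
  have nF : \forall m \near 0^'+,
      forall x, x \in F -> x != a -> m <= edot (x - a) (x - a).
    apply: (@near_fset R _ 0^'+) => x _.
    have [->|xa] := eqVneq x a; first by apply: nearW.
    near=> m => _; apply/ltW.
    by near: m; apply: nbhs_right_lt; rewrite edot_gt0 subr_eq0.
  near=> m; split.
  - by near: m; exact: nbhs_right_gt.
  - by near: m; exact: nbhs_right_lt.
  - by near: m; exact: nF.
case/filter_ex => m [m0 m1 Fm]; exists m => // x Ax xa.
have [le1|lt1] := leP (edot (x - a) (x - a)) 1; last by lra.
by apply: Fm => //; apply/FE.
Unshelve. all: by end_near. Qed.

(** Cauchy-Schwarz, obtained from [edot_AGM] by scaling [u] with [Q / m], which balances the two
    squares. *)
Lemma edot_small (m Q : R) p u : 0 < m -> 0 < Q -> edot p p <= Q ->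
  enorm u < Num.sqrt (m ^+ 2 / Q) -> edot p u <= m.
Proof.
move=> m0 Q0 pQ; have mQ0 : 0 < m ^+ 2 / Q by rewrite divr_gt0 ?exprn_gt0.
rewrite /enorm ltr_sqrt // => uQ.
have := edot_AGM p ((Q / m) *: u); rewrite !edotZl !edotZr => AGM.
have : Q / m * (Q / m * edot u u) <= Q.
  have QE : Q / m * (Q / m * (m ^+ 2 / Q)) = Q by field; rewrite !gt_eqF.
  by rewrite -[leRHS]QE !ler_pM2l ?divr_gt0 // ltW.
move=> uQ'; have : Q / m * edot p u <= Q by lra.
by rewrite mulrAC ler_pdivrMr // ler_pM2l.
Qed.

(* Pairing with [p] bounds the total weight: near [a] the simplex spanned by
   [a] and [X] coincides with its cone at [a]. *)
Lemma conv_hull_cone (m : R) y X p : a \notin X -> 0 < m ->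
  (forall x, x \in X -> m <= edot (x - a) (x - a)) ->
  (forall x, x \in X -> power a p x = 0) -> edot p (y - a) <= m ->
  conv_hull (a |` X)%fset y <->
  exists w : 'rV[R]_d -> R, (forall x, x \in X -> 0 <= w x) /\
    y - a = \sum_(x <- X) w x *: (x - a).
Proof.
move=> aX m0 Xm Xp ym; split=> [[w [w0 w1 yw]]|[w [w0 yw]]].
  exists w; split=> [x xX|]; first by rewrite w0 // !inE xX orbT.
  under eq_bigr do rewrite scalerBr.
  rewrite sumrB -scaler_suml; move: w1 yw; rewrite !big_fsetU1 //= => w1 ->.
  have -> : \sum_(x <- X) w x = 1 - w a by rewrite -w1; ring.
  by rewrite scalerBl scale1r opprB addrA; congr (_ - _); exact: addrC.
have sw : \sum_(x <- X) w x <= 1.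
  rewrite -(ler_pM2l m0) mulr1; apply: le_trans ym; rewrite yw edot_sumr mulr_sumr.
  rewrite big_seq [leRHS]big_seq; apply: ler_sum => x xX.
  have /eqP := Xp x xX; rewrite /power subr_eq0 edotZr => /eqP <-.
  by rewrite mulrC ler_wpM2l ?w0 ?Xm.
have neq_a x : x \in X -> (x == a) = false by move=> xX; apply: contraNF aX => /eqP <-.
exists (fun x => if x == a then 1 - \sum_(x <- X) w x else w x); split.
- move=> x; rewrite !inE; case: eqP => [_ _|_ /= /w0//]; lra.
- rewrite big_fsetU1 //= eqxx [X in _ + X](_ : _ = \sum_(x <- X) w x) ?subrK //.
  by apply: eq_big_seq => x /neq_a ->.
- rewrite big_fsetU1 //= eqxx [X in _ + X](_ : _ = \sum_(x <- X) w x *: x); last first.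
    by apply: eq_big_seq => x /neq_a ->.
  have {}yw : y - a = \sum_(x <- X) w x *: x - (\sum_(x <- X) w x) *: a.
    by rewrite yw scaler_suml -sumrB; apply: eq_bigr => x _; rewrite scalerBr.
  rewrite -[LHS](subrK a) yw scalerBl scale1r addrAC [RHS]addrAC.
  by congr (_ - _); exact: addrC.
Qed.

(** Both [p] and [p'] have the same prescribed products with the basis vectors [x - a]. *)
Lemma star_cell_sphere_uniq y X p p' : generic A -> A a ->
  star_cell A a y X p -> star_cell A a y X p' -> p = p'.
Proof.
move=> genA Aa [XA aX cX Xp _] [_ _ _ Xp' _].
have [q [_ qE]] := generic_dual_basis genA Aa XA aX cX.
apply/eqP; rewrite -subr_eq0 -edot_eq0 {2}(qE (p - p')) edot_sumr.
rewrite big_seq big1 // => x xX.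
rewrite edotZr edotBl; have := Xp x xX; have := Xp' x xX.
by rewrite /power => /subr0_eq <- /subr0_eq <-; rewrite subrr mulr0.
Qed.

End Hull.

(** * Counting hefty simplices *)

Section SubsetsOfFset.
Variables (K : choiceType) (N : {fset K}).
Implicit Types (X : {set N}) (Y : {fset K}).

Definition fset_of_set X : {fset K} := [fset val x | x in X]%fset.

Definition set_of_fset Y : {set N} := [set x : N | val x \in Y]%SET.

Lemma mem_fset_of_set X (x : N) : (val x \in fset_of_set X) = (x \in X).
Proof. by rewrite mem_imfset //; exact: val_inj. Qed.

Lemma fset_of_setP X x :
  reflect (exists2 z : N, z \in X & x = val z) (x \in fset_of_set X).
Proof. exact: imfsetP. Qed.

Lemma fset_of_set_sub X : (fset_of_set X `<=` N)%fset.
Proof. by apply/fsubsetP => x /fset_of_setP[z _ ->]; exact: valP. Qed.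

Lemma card_fset_of_set X : #|` fset_of_set X| = #|X|.
Proof. by rewrite card_imfset; [rewrite -cardE | exact: val_inj]. Qed.

Lemma set_of_fsetK Y : (Y `<=` N)%fset -> fset_of_set (set_of_fset Y) = Y.
Proof.
move=> /fsubsetP sYN; apply/fsetP => x; apply/fset_of_setP/idP => [[z]|xY].
  by rewrite inE => zY ->.
by exists [` sYN _ xY]%fset; rewrite ?inE.
Qed.

Lemma fset_of_set_inj : injective fset_of_set.
Proof. by move=> X X' eqX; apply/setP => x; rewrite -!mem_fset_of_set eqX. Qed.

End SubsetsOfFset.

Section Main.
Variables (R : realType) (d : nat) (A : set 'rV[R]_d.+1) (a : 'rV[R]_d.+1).
Hypotheses (genA : generic A) (delA : thin_Delone A) (Aa : A a).
Implicit Types (p x y : 'rV[R]_d.+1) (X Y B H : {fset 'rV[R]_d.+1}).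

Definition inside p H := forall x, x \in H <-> A x /\ power a p x < 0.

Lemma inside_exists p : exists H, inside p H.
Proof.
have [F FE] := locally_finite_edot a (edot p p) delA.1.
exists [fset x in F | power a p x < 0]%fset => x; rewrite !inE /=; split.
  by move=> /andP[/FE[]].
move=> [Ax px]; rewrite px andbT; apply/FE; split => //.
exact: power_le0_bound (ltW px).
Qed.

Lemma inside_bound (k : nat) : exists2 Q : R, 0 < Q &
  forall p H, inside p H -> (#|` H| <= k)%N -> edot p p <= Q.
Proof.
have [C HC] := few_inside_bounded a k delA.2.
(* The factor [d.+1] passes from the sup norm to the Euclidean one; the summand 1 ensures
   positivity. *)
exists (C ^+ 2 *+ d.+1 + 1) => [|p H pH cH].
  by rewrite ltr_wpDl // mulrn_wge0 // sqr_ge0.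
have pC : `|p| <= C.
  apply: HC => G GA Gp; apply: leq_trans cH; apply: fsubset_leq_card.
  by apply/fsubsetP => x xG; apply/pH; split; [exact: GA | exact: Gp].
apply: (le_trans (edot_le_norm p)); apply: ler_wpDr => //.
by rewrite lerMn2r lerXn2r ?nnegrE // (le_trans _ pC).
Qed.

(** * Transfer to a finite set [N] of candidate points *)

Section Count.
Variables (k : nat) (y : 'rV[R]_d.+1) (N : {fset 'rV[R]_d.+1}).
Hypothesis gy : generic_wrt A y.
Hypothesis aN : a \notin N.
Hypothesis NA : [set` N] `<=` A.
Hypothesis bigN : forall p H, inside p H -> (#|` H| <= k)%N ->
  forall x, A x -> x != a -> power a p x <= 0 -> x \in N.

(** Without the condition on [H], [inside_set X] could miss inside points outside [N], and
    [inside_set X \subset B] would not mean that removing [B] empties the sphere. *)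
Definition star_in (X : {set N}) : bool :=
  `[< exists p, star_cell A a y (fset_of_set X) p /\
        exists2 H, inside p H & (H `<=` N)%fset >].

(** The existential avoids choosing [p], which is unique by [star_cell_sphere_uniq]. *)
Definition inside_set (X : {set N}) : {set N} :=
  [set x : N | `[< exists2 p, star_cell A a y (fset_of_set X) p &
                     power a p (val x) < 0 >]]%SET.

Lemma inside_setP (X : {set N}) p H : star_cell A a y (fset_of_set X) p ->
  inside p H -> (H `<=` N)%fset -> fset_of_set (inside_set X) = H.
Proof.
move=> Xp pH HN; have <- := set_of_fsetK HN; congr fset_of_set; apply/setP => x.
rewrite !inE; apply/asboolP/idP => [[p' Xp' xp']|/pH[_ px]]; last by exists p.
apply/pH; split; first by apply: NA; exact: valP.
by rewrite (star_cell_sphere_uniq genA Aa Xp Xp').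
Qed.

Lemma star_in_card (X : {set N}) : star_in X ->
  #|X| = d.+1 /\ [disjoint X & inside_set X]%B.
Proof.
case/asboolP => p [Xp _]; have [_ _ cX X0 _] := Xp.
split; first by rewrite -card_fset_of_set.
rewrite disjoint_subset; apply/fintype.subsetP => x xX; rewrite !inE.
apply/asboolPn => -[p' Xp']; rewrite -(star_cell_sphere_uniq genA Aa Xp Xp').
by rewrite X0 ?ltxx // mem_fset_of_set.
Qed.

Lemma star_in_voronoi (B X : {set N}) :
  [&& star_in X, inside_set X \subset B & [disjoint X & B]%B] <->
  exists p, star_cell (A `\` [set` fset_of_set B]) a y (fset_of_set X) p /\
            voronoi (A `\` [set` fset_of_set B]) a p.
Proof.
split=> [/and3P[/asboolP[p [Xp [H pH HN]]] /fintype.subsetP sIB dXB]|[p [Xp Vp]]].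
  exists p; have [XA aX cX X0 w] := Xp; split.
    split => // x xX; split; first exact: XA.
    move: xX => /= /fset_of_setP[z zX ->]; rewrite mem_fset_of_set.
    by rewrite (disjointFr dXB zX).
  move=> x [Ax nBx]; rewrite leNgt; apply/negP => px; apply: nBx => /=.
  have : x \in H by apply/pH.
  rewrite -(inside_setP Xp pH HN) => /fset_of_setP[z zI ->].
  by rewrite mem_fset_of_set sIB.
have [XA aX cX X0 w] := Xp.
have {}Xp : star_cell A a y (fset_of_set X) p by split => // x /XA[].
have [H pH] := inside_exists p.
have HB : (H `<=` fset_of_set B)%fset.
  apply/fsubsetP => x /pH[Ax px]; apply: contraT => /negP nBx.
  by have := Vp x (conj Ax nBx); rewrite leNgt px.
have HN := fsubset_trans HB (fset_of_set_sub B).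
apply/and3P; split.
- by apply/asboolP; exists p; split => //; exists H.
- apply/fintype.subsetP => x; rewrite -mem_fset_of_set (inside_setP Xp pH HN).
  by move/(fsubsetP HB); rewrite mem_fset_of_set.
- rewrite disjoint_subset; apply/fintype.subsetP => x.
  rewrite -mem_fset_of_set => /XA[_ /=].
  by rewrite mem_fset_of_set inE => /negP.
Qed.

(** The sphere of the empty cell of [A] without [B] has all its inside points in [B], hence at most
    [k], and [bigN] puts [Y] into [N]. *)
Lemma star_in_unique (B : {set N}) : (#|B| <= k)%N ->
  #|[set X | [&& star_in X, inside_set X \subset B & [disjoint X & B]%B]]%SET| = 1%N.
Proof.
move=> cB; set A' := A `\` [set` fset_of_set B].
have sA : A' `<=` A by move=> x [].
have Aa' : A' a.
  by split => //= aB; case/negP: aN; exact: (fsubsetP (fset_of_set_sub B)).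
have genA' := generic_sub sA genA; have gy' := generic_wrt_sub sA gy.
have [Y [p [Yp Vp]]] :=
  empty_star_exists Aa' genA' (ltn0Sn d) (thin_DeloneD (fset_of_set B) delA) gy'.
have [YA aY cY Y0 _] := Yp.
have [H pH] := inside_exists p.
have cH : (#|` H| <= k)%N.
  apply: leq_trans cB; rewrite -card_fset_of_set; apply: fsubset_leq_card.
  apply/fsubsetP => x /pH[Ax px]; apply: contraT => /negP nBx.
  by have := Vp x (conj Ax nBx); rewrite leNgt px.
have YN : (Y `<=` N)%fset.
  apply/fsubsetP => x xY; apply: (bigN pH cH); rewrite ?Y0 //.
    by have [] := YA x xY.
  by apply: contraNneq aY => <-.
apply/eqP/cards1P; exists (set_of_fset N Y); apply/setP => X.
rewrite !inE; apply/idP/eqP => [/star_in_voronoi[p' [Xp' Vp']]|->].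
  apply: fset_of_set_inj; rewrite set_of_fsetK //.
  exact (empty_star_unique Aa' genA' gy' Xp' Vp' Yp Vp).
by apply/star_in_voronoi; exists p; rewrite set_of_fsetK.
Qed.

Lemma card_star_in :
  #|[set X | star_in X && (#|inside_set X| == k)]%SET| = 'C(d + k, k).
Proof. exact: card_by_depth star_in_card star_in_unique _ (leqnn k). Qed.

(** So close to [a], [conv_hull_cone] replaces simplices by cones; adding [a] then maps the cells of
    [card_star_in] bijectively onto the simplices sought. *)
Lemma card_hefty_star (m Q : R) : 0 < m -> 0 < Q ->
  (forall x, A x -> x != a -> m <= edot (x - a) (x - a)) ->
  (forall p H, inside p H -> (#|` H| <= k)%N -> edot p p <= Q) ->
  enorm (y - a) < Num.sqrt (m ^+ 2 / Q) ->
  ([set S : {fset 'rV[R]_d.+1} | hefty A k S /\ a \in S /\ conv_hull S y]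
     #= `I_('C(d + k, k)))%card.
Proof.
move=> m0 Q0 sepA bdA ya.
pose D := [set X | star_in X && (#|inside_set X| == k)]%SET.
pose f (X : {set N}) := (a |` fset_of_set X)%fset.
have aX (X : {set N}) : a \notin fset_of_set X.
  by apply: contra aN; exact: (fsubsetP (fset_of_set_sub X)).
have hull X p H : [set` X] `<=` A -> a \notin X ->
    (forall x, x \in X -> power a p x = 0) -> inside p H -> (#|` H| <= k)%N ->
    conv_hull (a |` X)%fset y <->
    exists w : 'rV[R]_d.+1 -> R, (forall x, x \in X -> 0 <= w x) /\
      y - a = \sum_(x <- X) w x *: (x - a).
  move=> XA naX X0 pH cH; apply: (conv_hull_cone naX m0 _ X0).
    by move=> x xX; apply: sepA; [exact: XA | apply: contraNneq naX => <-].
  exact: edot_small m0 Q0 (bdA _ _ pH cH) ya.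
have f_inj : injective f.
  move=> X X' /(congr1 (fun S => S `\ a)%fset); rewrite /f !fsetU1K //.
  exact: fset_of_set_inj.
suff -> : [set S | hefty A k S /\ a \in S /\ conv_hull S y] =
    [set` [fset f X | X in D]%fset].
  by apply/card_eq_fsetP; rewrite card_imfset //= -cardE card_star_in.
apply/seteqP; split => [S [[[SA cS] [c [r [[r0 Sc] ballk]]]] [aS Sy]]|S /=].
  have ac : esphere c r a by exact: Sc.
  set p := 2 *: (c - a).
  pose Y := (S `\ a)%fset.
  have SE : (a |` Y)%fset = S by rewrite fsetD1K.
  have aY : a \notin Y by rewrite !inE eqxx.
  have YA : [set` Y] `<=` A by move=> x /=; rewrite !inE => /andP[_ /SA].
  have cY : #|` Y| = d.+1.
    by move: cS; rewrite (cardfsD1 a) aS add1n => -[].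
  have Y0 x : x \in Y -> power a p x = 0.
    by rewrite !inE => /andP[_ xS]; apply/(esphere_power x ac); exact: Sc.
  have [H pH] := inside_exists p.
  have HE : A `&` eopen_ball c r = [set` H].
    apply/seteqP; split => x /=.
      by move=> [Ax xc]; apply/pH; split => //; apply/(eopen_ball_power x r0 ac).
    by case/pH => Ax px; split => //; apply/(eopen_ball_power x r0 ac).
  have cH : #|` H| = k by apply/card_eq_fsetP; rewrite -HE.
  have cHk : (#|` H| <= k)%N by rewrite cH.
  have HN : (H `<=` N)%fset.
    apply/fsubsetP => x /pH[Ax px]; apply: (bigN pH cHk) => //; last exact: ltW.
    by apply: contraTneq px => ->; rewrite power_self ltxx.
  have YN : (Y `<=` N)%fset.
    apply/fsubsetP => x xY; apply: (bigN pH cHk); rewrite ?Y0 //; first exact: YA.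
    by apply: contraNneq aY => <-.
  have Yp : star_cell A a y Y p.
    by split => //; apply/(hull Y p H YA aY Y0 pH cHk); rewrite SE.
  apply/imfsetP; exists (set_of_fset N Y); last by rewrite /f set_of_fsetK.
  rewrite -(set_of_fsetK YN) in Yp.
  rewrite inE; apply/andP; split.
    by apply/asboolP; exists p; split => //; exists H.
  by rewrite -card_fset_of_set (inside_setP Yp pH HN) cH.
case/imfsetP => X; rewrite inE => /andP[/asboolP[p [Xp [H pH HN]]] /eqP cI] ->.
have cH : #|` H| = k by rewrite -(inside_setP Xp pH HN) card_fset_of_set.
have cHk : (#|` H| <= k)%N by rewrite cH.
have [XA naX cX X0 w] := Xp.
split; last split; [|by rewrite !inE eqxx|exact/(hull _ p H XA)].
split.
  split; last by rewrite cardfsU1 naX cX.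
  by move=> x /=; rewrite !inE => /orP[/eqP ->//|/XA].
have [c pE] := power_center a p.
have [x xX] : exists x, x \in fset_of_set X.
  by apply/fset0Pn; rewrite -cardfs_gt0 cX.
have r0 : 0 < enorm (a - c).
  rewrite sqrtr_gt0 edot_gt0; apply/eqP => /subr0_eq acE.
  have xa : x != a by apply: contraNneq naX => <-.
  have := power_le0_neq0 (p := p) xa; rewrite X0 // lexx => /(_ isT).
  by rewrite pE acE subrr scaler0 eqxx.
have ac : esphere c (enorm (a - c)) a by [].
exists c, (enorm (a - c)); split.
  split => // z /=; rewrite !inE => /orP[/eqP ->//|zX].
  by apply/(esphere_power z ac); rewrite -pE X0.
suff -> : A `&` eopen_ball c (enorm (a - c)) = [set` H] by exact/card_eq_fsetP.
apply/seteqP; split => z /=.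
  by move=> [Az zc]; apply/pH; split => //; rewrite pE;
    apply/(eopen_ball_power z r0 ac).
by case/pH => Az; rewrite pE => pz; split => //; apply/(eopen_ball_power z r0 ac).
Qed.

End Count.
End Main.

Theorem theorem3 (R : realType) (d : nat) (hd : (1 <= d)%N)
    (A : set 'rV[R]_d) (hgen : generic A) (hDel : thin_Delone A)
    (k : nat) (a : 'rV[R]_d) (ha : A a) :
  exists eps : R, 0 < eps /\
    forall y : 'rV[R]_d, enorm (y - a) < eps -> generic_wrt A y ->
      ([set S : {fset 'rV[R]_d} | hefty A k S /\ a \in S /\ conv_hull S y]
         #= `I_('C(d + k - 1, d - 1)))%card.
Proof.
case: d hd A hgen hDel a ha => // d _ A genA delA a Aa.
have [m m0 sepA] := separated_point a delA.1.
have [Q Q0 bdA] := inside_bound a delA k.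
(* Within this radius, [edot p (y - a) <= m] for every [p] of squared length at most [Q]. *)
exists (Num.sqrt (m ^+ 2 / Q)); split.
  by rewrite sqrtr_gt0 divr_gt0 ?exprn_gt0.
move=> y ya gy.
have -> : 'C(d.+1 + k - 1, d.+1 - 1) = 'C(d + k, k).
  by rewrite addSn !subn1 /= -[in RHS]bin_sub ?leq_addl // addnK.
(* A sphere through [a] with at most [k] inside points has squared diameter at most [Q], so [F]
   contains all points of [A] on or inside it. *)
have [F FE] := locally_finite_edot a Q delA.1.
apply: (@card_hefty_star _ _ _ _ genA delA Aa k y (F `\ a)%fset gy _ _ _ m Q) => //.
- by rewrite !inE eqxx.
- by move=> x /=; rewrite !inE => /andP[_ /FE[]].
- move=> p H pH cH x Ax xa px; rewrite !inE xa /=; apply/FE; split => //.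
  exact: le_trans (power_le0_bound px) (bdA _ _ pH cH).
Qed.
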